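(* Let $\mathfrak{B}$ be a bornology with a closed base on a topological space $X$. The following hold. (1) $X$ satisfies $S_1(\Gamma_{\mathfrak{B}},\Gamma_{\mathfrak{B}})$ if and only if $X$ satisfies $S_{fin}(\Gamma_{\mathfrak{B}},\Gamma_{\mathfrak{B}})$. (2) $X$ satisfies $S_1(\Gamma_{\mathfrak{B}},\Gamma)$ if and only if $X$ satisfies $S_{fin}(\Gamma_{\mathfrak{B}},\Gamma)$. (3) $X$ satisfies $S_1(\Gamma,\Gamma_{\mathfrak{B}})$ if and only if $X$ satisfies $S_{fin}(\Gamma,\Gamma_{\mathfrak{B}})$.
   Context: A bornology $\mathfrak{B}$ on $X$ is a family of subsets of $X$ that is closed under taking subsets and finite unions and covers $X$; by standing convention $X\notin\mathfrak{B}$. A base of $\mathfrak{B}$ is a subfamily $\mathfrak{B}_0\subseteq\mathfrak{B}$ such that every $B\in\mathfrak{B}$ is contained in some $B_0\in\mathfrak{B}_0$; it is closed if its members are closed subsets of $X$. $\Gamma_{\mathfrak{B}}$ is the collection of all $\gamma_{\mathfrak{B}}$-covers of $X$: infinite covers $\mathcal{U}=\{U_n:n\in\omega\}$ of $X$ by proper open subsets such that for each $B\in\mathfrak{B}$ there is $n_0\in\omega$ with $B\subseteq U_n$ for all $n\ge n_0$. $\Gamma$ is the collection of all $\gamma$-covers of $X$: infinite open covers $\mathcal{U}$ such that for each $x\in X$ the set $\{U\in\mathcal{U}:x\notin U\}$ is finite. For collections $\mathcal{A},\mathcal{B}$ of families of subsets of $X$: $S_1(\mathcal{A},\mathcal{B})$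 means that for each sequence $\{\mathcal{U}_n:n\in\omega\}$ of elements of $\mathcal{A}$ there are $V_n\in\mathcal{U}_n$ ($n\in\omega$) with $\{V_n:n\in\omega\}\in\mathcal{B}$. $S_{fin}(\mathcal{A},\mathcal{B})$ means that for each such sequence there are finite (possibly empty) $\mathcal{V}_n\subseteq\mathcal{U}_n$ with $\bigcup_{n\in\omega}\mathcal{V}_n\in\mathcal{B}$. *)

(* Defs.v *)
From mathcomp Require Import all_boot all_order.
From mathcomp Require Import boolp classical_sets functions cardinality topology.

Set Implicit Arguments.
Unset Strict Implicit.
Unset Printing Implicit Defensive.

Local Open Scope classical_set_scope.

Definition covers {X : Type} (U : set (set X)) : Prop :=
  \bigcup_(A in U) A = [set: X].

(* [bornology_proper] is not part of the usual definition of a bornology: it is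
   the standing convention that the whole space is never a member. *)
Record bornology {X : Type} (B : set (set X)) : Prop := Bornology {
  bornology_sub : forall A C : set X, B C -> A `<=` C -> B A ;
  bornology_setU : forall A C : set X, B A -> B C -> B (A `|` C) ;
  bornology_covers : covers B ;
  bornology_proper : ~ B [set: X] }.

Definition bornology_base {X : Type} (B B0 : set (set X)) : Prop :=
  B0 `<=` B /\ forall A, B A -> exists2 A0, B0 A0 & A `<=` A0.

Definition has_closed_base {X : topologicalType} (B : set (set X)) : Prop :=
  exists2 B0, bornology_base B B0 & forall A, B0 A -> closed A.

(* A cover is a set of sets, so "infinite" refers to the number of distinct
   members; the enumeration [u] may repeat some of them. *)
Definition GammaB {X : topologicalType} (B : set (set X)) : set (set (set X)) :=
  [set U | [/\ infinite_set U, covers U,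
               (forall A, U A -> open A /\ A <> [set: X]) &
               exists2 u : nat -> set X, U = range u &
                 forall A, B A -> exists n0 : nat,
                   forall n : nat, (n0 <= n)%N -> A `<=` u n]].

(* Members are not required to be proper, nor the cover to be countable. *)
Definition Gamma {X : topologicalType} : set (set (set X)) :=
  [set U | [/\ infinite_set U, covers U,
               (forall A, U A -> open A) &
               forall x : X, finite_set [set A | U A /\ ~ A x]]].

Definition S1 {X : Type} (P Q : set (set (set X))) : Prop :=
  forall U : nat -> set (set X), (forall n, P (U n)) ->
  exists2 V : nat -> set X, (forall n, U n (V n)) & Q (range V).

Definition Sfin {X : Type} (P Q : set (set (set X))) : Prop :=
  forall U : nat -> set (set X), (forall n, P (U n)) ->
  exists2 V : nat -> set (set X),
    (forall n, finite_set (V n) /\ V n `<=` U n) & Q (\bigcup_n V n).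

(* Main.v *)
Require Import Defs.
From mathcomp Require Import all_boot all_order.
From mathcomp Require Import finmap.
From mathcomp Require Import boolp classical_sets functions cardinality topology.

(** [S1] implies [Sfin] by selecting singletons.  For the converse, every cover
    in sight is treated as a convergent sequence of open sets, where convergence
    is measured by a family [F] of test sets: each test set must lie in all but
    finitely many terms.  The bornology is the test family of [GammaB B], the
    singletons are the test family of [Gamma], and [tested_by] collects what is
    needed to pass between covers of the given kind and such sequences.

    Given covers [U n], choose from each a convergent sequence [u n] of proper
    open sets and apply [Sfin] to the ranges of the partial intersections
    [W n m = u 0 m `&` ... `&` u n m], which converge along the same test sets.
    The finite selections have an infinite union, so for every [i] it contains a
    set [W n m] that was not selected before stage [i].  Then [i <= n], hence
    [W n m] is contained in [u i m], and [u i m] is the set chosen from [U i].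
    Since each stage contributes finitely many sets, every selected set is used
    for finitely many [i] only; so a test set, which is missed by finitely many
    selected sets, is missed by finitely many of the chosen ones.  That the
    chosen sets are infinitely many is then automatic: as they are proper, none
    of them can be repeated infinitely often along a convergent sequence.

    This argument allows different test families for source and target, and all
    three equivalences are instances of it. *)

Set Implicit Arguments.
Unset Strict Implicit.
Unset Printing Implicit Defensive.

Local Open Scope classical_set_scope.

(** * Sequences that take each value finitely often *)

Definition leaves_values {T : Type} (a : nat -> T) : Prop :=
  forall x, \forall n \near \oo, a n <> x.

Lemma leaves_values_finite_set {T : Type} (a : nat -> T) (S : set T) :
  leaves_values a -> finite_set S -> \forall n \near \oo, ~ S (a n).
Proof.
(* Finite intersections in a filter are indexed by a choice type. *)
move=> la; move: T a S la; apply: Pchoice => T a S la finS.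
have /finite_fsetP[D ->] := finS.
have /filterS : \forall n \near \oo,
    (\bigcap_(x in [set` D]) [set k | a k <> x]) n.
  by apply: filter_bigI => x _; exact: la.
by apply => n hn Dan; exact: (hn (a n)).
Qed.

Lemma leaves_values_infinite_range {T : Type} (a : nat -> T) :
  leaves_values a -> infinite_set (range a).
Proof.
move=> la fin; have [N _ hN] := leaves_values_finite_set la fin.
by apply: (hN N) => /=; [exact: leqnn | exists N].
Qed.

Lemma injective_leaves_values {T : Type} (a : nat -> T) :
  injective a -> leaves_values a.
Proof.
move=> inj x; have [[k ak]|nx] := pselect (exists k, a k = x).
  by exists k.+1 => // n /= kn; rewrite -ak => /inj nk; rewrite nk ltnn in kn.
by apply: nearW => n an; apply: nx; exists n.
Qed.

Lemma infinite_set_injective_seq {T : Type} (S : set T) :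
  infinite_set S -> exists2 a : nat -> T, injective a & forall n, S (a n).
Proof.
move=> infS; have [x0 _] := infinite_setN0 infS.
have /infiniteP/card_leP[f] := infS.
pose a n := set_val (f (SigSub (mem_set (I : [set: nat] n)))).
exists a => [m n|n]; last exact: set_valP.
by move=> /val_inj /(@inj _ _ _ f); rewrite !inE => /(_ I I) [].
Qed.

(** * Convergence along a family of test sets *)

Section TestSets.
Context {X : topologicalType}.
Implicit Types (F G : set (set X)) (u v w : nat -> set X).
Implicit Types (P Q : set (set (set X))) (U : set (set X)).

Definition converges F u : Prop :=
  forall C, F C -> \forall n \near \oo, C `<=` u n.

Definition proper_open (A : set X) : Prop := open A /\ A <> [set: X].

(** A point outside a value of [u] lies in a test set, which is absorbed by the
    terms of [u]; so that value does not recur. *)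
Lemma converges_leaves_values F u :
  covers F -> (forall n, proper_open (u n)) -> converges F u -> leaves_values u.
Proof.
move=> covF pu cu A.
have [[k uk]|nA] := pselect (exists k, u k = A); last first.
  by apply: nearW => n un; apply: nA; exists n.
have [x nAx] : exists x, ~ A x.
  apply/existsNP => allA; have [_ []] := pu k.
  by rewrite uk; apply/seteqP; split.
have [C FC Cx] : (\bigcup_(C in F) C) x by rewrite covF.
by apply: filterS (cu C FC) => n Cun un; apply: nAx; rewrite -un; exact: Cun.
Qed.

Lemma converges_covers F u : covers F -> converges F u -> covers (range u).
Proof.
move=> covF cu; apply/seteqP; split => // x _.
have [C FC Cx] : (\bigcup_(C in F) C) x by rewrite covF.
have [N _ hN] := cu C FC.
by exists (u N); [exists N | exact: (hN N (leqnn N)) x Cx].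
Qed.

Lemma converges_finite_missing F u C : converges F u -> F C ->
  finite_set [set A | range u A /\ ~ C `<=` A].
Proof.
move=> cu FC; have [N _ hN] := cu C FC.
apply: (@sub_finite_set _ _ (u @` `I_N)); last exact/finite_image/finite_II.
move=> A [[n _ <-] nCA]; exists n => //=.
by rewrite ltnNge; apply/negP => Nn; apply: nCA; exact: hN.
Qed.

Lemma leaves_values_converges F U u :
  (forall C, F C -> finite_set [set A | U A /\ ~ C `<=` A]) ->
  (forall n, U (u n)) -> leaves_values u -> converges F u.
Proof.
move=> fin Uu lu C FC.
apply: filterS (leaves_values_finite_set lu (fin C FC)) => n hn.
by apply: contrapT => nC; apply: hn.
Qed.

(** Intersecting finitely many convergent sequences termwise only shrinks the
    index set on which a test set is contained in the term. *)
Lemma converges_bigcap F (u : nat -> nat -> set X) k :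
  (forall i, converges F (u i)) ->
  converges F (fun m => \bigcap_(i < k) u i m).
Proof.
move=> cu C FC.
have : \forall m \near \oo, forall i : 'I_k, C `<=` u i m.
  by apply: filter_forall => i; exact: cu.
by apply: filterS => m hm x Cx i /= ik; exact: (hm (Ordinal ik)).
Qed.

Lemma proper_open_bigcap (u : nat -> nat -> set X) k m :
  (forall i, proper_open (u i m)) -> proper_open (\bigcap_(i < k.+1) u i m).
Proof.
move=> pu; split.
  rewrite bigcap_mkord; apply: big_ind => [||i _]; first exact: openT.
    exact: openI.
  by have [] := pu i.
move=> eT; have [_ []] := pu 0; apply/seteqP; split => // x _.
have: (\bigcap_(i < k.+1) u i m) x by rewrite eT.
by apply.
Qed.

(** * Selecting one set from each cover *)

(** The ranges of convergent sequences of proper open sets are members of [P],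
    and conversely each member contains such a sequence.  It need not be the
    range of one, as a [Gamma]-cover can be uncountable or contain the space. *)
Record tested_by P F : Prop := TestedBy {
  tested_seq : forall U, P U -> exists2 u : nat -> set X,
    (forall n, U (u n) /\ proper_open (u n)) & converges F u ;
  tested_range : forall u,
    (forall n, proper_open (u n)) -> converges F u -> P (range u) ;
  tested_infinite : forall U, P U -> infinite_set U ;
  tested_finite_missing : forall U C, P U -> F C ->
    finite_set [set A | U A /\ ~ C `<=` A] }.

(** From infinitely many sets, finitely many at each stage, a set that is new at
    stage [i] can be taken for every [i]; the choices for different [i] may
    coincide, but each set is chosen finitely often. *)
Lemma bigcup_finite_late_choice {T : Type} (V : nat -> set T) :
  (forall n, finite_set (V n)) -> infinite_set (\bigcup_n V n) ->
  exists2 a : nat -> T,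
    forall i, exists2 n, (i <= n)%N & V n (a i) & leaves_values a.
Proof.
move=> finV infV.
have /choice[a ha] (i : nat) :
    exists x, (\bigcup_n V n `\` \bigcup_(n < i) V n) x.
  apply/infinite_setN0/infinite_setD => //.
  by apply: bigcup_finite => //; exact: finite_II.
exists a => [i|x].
  have [[n _ Vn] nV] := ha i; exists n => //.
  by rewrite leqNgt; apply/negP => ni; apply: nV; exists n.
have [[n _ Vnx]|nx] := pselect ((\bigcup_n V n) x).
  exists n.+1 => // i /= ni aix; have [_ nV] := ha i.
  by apply: nV; exists n => //; rewrite aix.
by apply: nearW => i aix; apply: nx; rewrite -aix; have [] := ha i.
Qed.

Lemma Sfin_S1 P Q F G : tested_by P F -> tested_by Q G -> Sfin P Q -> S1 P Q.
Proof.
move=> tP tQ finPQ U PU.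
have /choice[u hu] (n : nat) : exists u : nat -> set X,
    (forall m, U n (u m) /\ proper_open (u m)) /\ converges F u.
  by have [u ? ?] := tested_seq tP (PU n); exists u.
have pu n m : proper_open (u n m) by have [/(_ m)[]] := hu n.
pose W n m := \bigcap_(i < n.+1) u i m.
have [n|V subV QV] := finPQ (fun n => range (W n)).
  apply: (tested_range tP) => [m|]; first exact: proper_open_bigcap.
  by apply: converges_bigcap => i; have [] := hu i.
have finV n : finite_set (V n) by have [] := subV n.
have [a aV la] := bigcup_finite_late_choice finV (tested_infinite tQ QV).
(* [a i] is a term of [W n] with [i <= n], so [u i] is among its factors. *)
have /choice[m am] (i : nat) : exists m, a i `<=` u i m.
  have [n iN Va] := aV i; have [_ /(_ _ Va)[m _ <-]] := subV n.
  by exists m => x; apply.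
exists (fun i => u i (m i)) => [i|]; first by have [/(_ (m i))[]] := hu i.
apply: (tested_range tQ) => // C GC.
have ca : converges G a.
  apply: (@leaves_values_converges _ (\bigcup_n V n)) => // [D GD|i].
    exact: (tested_finite_missing tQ QV GD).
  by have [n _ Va] := aV i; exists n.
by apply: filterS (ca C GC) => i Ca; exact: subset_trans Ca (am i).
Qed.

Lemma S1_Sfin P Q : S1 P Q -> Sfin P Q.
Proof.
move=> s1 U PU; have [V UV QV] := s1 U PU.
exists (fun n => [set V n]); last by rewrite bigcup_imset1.
by move=> n; split; [exact: finite_set1 | move=> _ ->].
Qed.

Lemma S1_Sfin_iff P Q F G :
  tested_by P F -> tested_by Q G -> S1 P Q <-> Sfin P Q.
Proof. by move=> tP tQ; split; [exact: S1_Sfin | exact: Sfin_S1 tP tQ]. Qed.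

(** * The two kinds of covers *)

Lemma GammaB_tested_by (B : set (set X)) :
  bornology B -> tested_by (GammaB B) B.
Proof.
move=> hB; have covB := bornology_covers hB; split.
- move=> U [_ _ poU [u Uu cu]]; exists u => [n|C BC].
    by have Un : U (u n) by [rewrite Uu; exists n]; split; [|exact: poU].
  by have [N hN] := cu C BC; exists N.
- move=> u pu cu; split.
  + exact/leaves_values_infinite_range/(converges_leaves_values covB).
  + exact: converges_covers cu.
  + by move=> _ [n _ <-]; exact: pu.
  + by exists u => // C /cu[N _ hN]; exists N.
- by move=> U [].
- move=> U C [_ _ _ [u -> cu]]; apply: converges_finite_missing => D BD.
  by have [N hN] := cu D BD; exists N.
Qed.

Lemma covers_singletons : covers (range (@set1 X)).
Proof. by apply/seteqP; split => // x _; exists [set x]; first exists x. Qed.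

Lemma Gamma_tested_by : tested_by Gamma (range (@set1 X)).
Proof.
have missE U x : [set A | U A /\ ~ [set x] `<=` A] = [set A | U A /\ ~ A x].
  by apply/seteqP; split => A [UA nA]; split => // xA; apply: nA;
    [move=> _ -> | exact: xA].
split.
- move=> U [infU _ oU finU].
  (* The whole space may belong to [U]; it is discarded. *)
  have [u inju Uu] := infinite_set_injective_seq
    (infinite_setD infU (finite_set1 [set: X])).
  exists u => [n|].
    by have [Un nT] := Uu n; split=> //; split=> //; exact: oU.
  apply: (@leaves_values_converges _ U) => [_ [x _ <-]|n|].
  + by rewrite missE; exact: finU.
  + by have [] := Uu n.
  + exact: injective_leaves_values.
- move=> u pu cu; split.
  + exact/leaves_values_infinite_range/
      (converges_leaves_values covers_singletons).
  + exact: converges_covers covers_singletons cu.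
  + by move=> _ [n _ <-]; have [] := pu n.
  + by move=> x; rewrite -missE; apply: converges_finite_missing cu _; exists x.
- by move=> U [].
- by move=> U _ [_ _ _ finU] [x _ <-]; rewrite missE; exact: finU.
Qed.

End TestSets.

Theorem theorem3p7 (X : topologicalType) (B : set (set X))
    (hB : bornology B) (hcl : has_closed_base B) :
  [/\ S1 (GammaB B) (GammaB B) <-> Sfin (GammaB B) (GammaB B),
      S1 (GammaB B) Gamma <-> Sfin (GammaB B) Gamma
    & S1 Gamma (GammaB B) <-> Sfin Gamma (GammaB B)].
Proof.
have tB := GammaB_tested_by hB; have tG := @Gamma_tested_by X.
by split; apply: S1_Sfin_iff; eassumption.
Qed.
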